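(* Let $a,m$ be integers with $1<a<m$ and $\gcd(a,m)=1$, let $\Lambda(a,m)=\{(x,y)\in\mathbb{Z}\times\mathbb{Z}\mid ax+y\equiv 0 \pmod m\}$, and let $\widehat{v}_i^{(k)}$, $\mathcal{I}_k$, $q_k$ ($0\le k\le N$) be the s-state row vectors, inner products and quotients of Qin's algorithm on input $(a,m)$. Suppose there is an index $k_0$ with $0\le k_0<N$, $\mathcal{I}_{k_0}<0$ and $\mathcal{I}_{k_0+1}\ge 0$. For $0\le k\le N$ put $$D_{k}=q_{k}\mathcal{I}_{k}+\sum_{j=0}^{k-1}(-1)^{k-1-j}(q_{j+1}-q_{j})\mathcal{I}_{j}+(-1)^{k}(a^2+1-m^2),\qquad q_0=0.$$ If $|\mathcal{I}_{k_0}|\ge|\mathcal{I}_{k_0+1}|$, then: (a) when $D_{k_0+1}\ge 0$, $\widehat{v}_{2-\delta_{k_0+1}}^{(k_0+1)}$ is a shortest non-zero vector of $\Lambda(a,m)$; (b) when $D_{k_0+1}\le 0$, $\widehat{v}_{1+\delta_{k_0+1}}^{(k_0+1)}$ is a shortest non-zero vector of $\Lambda(a,m)$. If $|\mathcal{I}_{k_0}|\le|\mathcal{I}_{k_0+1}|$, then: (a) when $D_{k_0}\ge 0$, $\widehat{v}_{2-\delta_{k_0}}^{(k_0)}$ is a shortest non-zero vector of $\Lambda(a,m)$; (b) when $D_{k_0}\le 0$, $\widehat{v}_{1+\delta_{k_0}}^{(k_0)}$ is a shortest non-zero vector of $\Lambda(a,m)$.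
   Context: Lengths are Euclidean: $\|(x,y)\|^2=x^2+y^2$. A shortest non-zero vector of $\Lambda(a,m)$ is a non-zero element of $\Lambda(a,m)$ of minimal length. For an integer $k$, $\delta_k\in\{0,1\}$ is defined by $\delta_k\equiv k\pmod 2$. Qin's algorithm on input $(a,m)$ produces states $\mathcal{X}_k=\begin{pmatrix} x_{11}^{(k)} & x_{12}^{(k)}\\ x_{21}^{(k)} & x_{22}^{(k)}\end{pmatrix}$, starting from $\mathcal{X}_0=\begin{pmatrix}1&a\\0&m\end{pmatrix}$. For $k\ge 1$: - if $k$ is odd, $q_k=\left\lfloor \frac{x_{22}^{(k-1)}-1}{x_{12}^{(k-1)}}\right\rfloor$, $x_{21}^{(k)}=x_{21}^{(k-1)}+q_kx_{11}^{(k-1)}$, $x_{22}^{(k)}=x_{22}^{(k-1)}-q_kx_{12}^{(k-1)}$, and the first row is unchanged; - if $k$ is even, $q_k=\left\lfloor \frac{x_{12}^{(k-1)}-1}{x_{22}^{(k-1)}}\right\rfloor$, $x_{11}^{(k)}=x_{11}^{(k-1)}+q_kx_{21}^{(k-1)}$, $x_{12}^{(k)}=x_{12}^{(k-1)}-q_kx_{22}^{(k-1)}$, and the second row is unchanged. The algorithm terminates as soon as the upper right entry $x_{12}^{(k)}$ equals $1$; $N$ denotes the index of this terminating state. The s-state is $\widehat{\mathcal{X}_k}=\begin{pmatrix} x_{11}^{(k)} & -x_{12}^{(k)}\\ x_{21}^{(k)} & x_{22}^{(k)}\end{pmatrix}$, with row vectors $\widehat{v}_1^{(k)}=(x_{11}^{(k)},-x_{12}^{(k)})$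 and $\widehat{v}_2^{(k)}=(x_{21}^{(k)},x_{22}^{(k)})$. The inner product is $\mathcal{I}_k=\langle\widehat{v}_1^{(k)},\widehat{v}_2^{(k)}\rangle=x_{11}^{(k)}x_{21}^{(k)}-x_{12}^{(k)}x_{22}^{(k)}$, for $0\le k\le N$. *)

(* Defs.v *)
From mathcomp Require Import all_boot all_order all_algebra.
From mathcomp Require Import zify ring.

Set Implicit Arguments.
Unset Strict Implicit.
Unset Printing Implicit Defensive.

Import Order.TTheory GRing.Theory Num.Theory.
Local Open Scope ring_scope.

Definition mx22 (x11 x12 x21 x22 : int) : 'M[int]_2 :=
  \matrix_(i, j) if i == 0 then (if j == 0 then x11 else x12)
                 else (if j == 0 then x21 else x22).

(* Quotient and next state of step [k], computed from the state [X] of index   *)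
(* [k - 1].  The divisors are positive along the algorithm, so [divz] is the   *)
(* floor of the rational quotient.                                             *)
Definition qin_quo (k : nat) (X : 'M[int]_2) : int :=
  if odd k then divz (X 1 1 - 1) (X 0 1) else divz (X 0 1 - 1) (X 1 1).

Definition qin_step (k : nat) (X : 'M[int]_2) : 'M[int]_2 :=
  let q := qin_quo k X in
  if odd k then mx22 (X 0 0) (X 0 1) (X 1 0 + q * X 0 0) (X 1 1 - q * X 0 1)
  else mx22 (X 0 0 + q * X 1 0) (X 0 1 - q * X 1 1) (X 1 0) (X 1 1).

(* The recursion is not stopped at the terminal index; only the states of      *)
(* index at most [N], with [qin_terminal a m N], belong to the algorithm.      *)
Fixpoint qin_state (a m : int) (k : nat) : 'M[int]_2 :=
  if k is k'.+1 then qin_step k (qin_state a m k') else mx22 1 a 0 m.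

Definition qin_q (a m : int) (k : nat) : int :=
  if k is k'.+1 then qin_quo k (qin_state a m k') else 0.

Definition qin_terminal (a m : int) (N : nat) : Prop :=
  qin_state a m N 0 1 = 1 /\
  forall k : nat, (k < N)%N -> qin_state a m k 0 1 <> 1.

Definition qin_sstate (a m : int) (k : nat) : 'M[int]_2 :=
  let X := qin_state a m k in mx22 (X 0 0) (- X 0 1) (X 1 0) (X 1 1).

(* The row index [i] is 1-based: [i] is 1 or 2. *)
Definition qin_svec (a m : int) (k i : nat) : 'rV[int]_2 :=
  row (inord i.-1) (qin_sstate a m k).

Definition dotv (u v : 'rV[int]_2) : int := \sum_j u 0 j * v 0 j.

(* The square of the Euclidean length. *)
Definition sqnorm (v : 'rV[int]_2) : int := v 0 0 ^+ 2 + v 0 1 ^+ 2.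

Definition qin_inner (a m : int) (k : nat) : int :=
  dotv (qin_svec a m k 1) (qin_svec a m k 2).

Definition qin_D (a m : int) (k : nat) : int :=
  qin_q a m k * qin_inner a m k
  + \sum_(0 <= j < k)
      (-1) ^+ (k - 1 - j) * (qin_q a m j.+1 - qin_q a m j) * qin_inner a m j
  + (-1) ^+ k * (a ^+ 2 + 1 - m ^+ 2).

Definition lattice (a m : int) : {pred 'rV[int]_2} :=
  [pred v : 'rV[int]_2 | ((a * v 0 0 + v 0 1)%R == 0 %[mod m])%Z].

(* Lengths are nonnegative, so they are compared through their squares. *)
Definition is_shortest (a m : int) (v : 'rV[int]_2) : Prop :=
  [/\ v \in lattice a m, v != 0 &
      forall w : 'rV[int]_2, w \in lattice a m -> w != 0 ->
        sqnorm v <= sqnorm w].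

Lemma mx22E (x11 x12 x21 x22 : int) :
  (mx22 x11 x12 x21 x22 0 0 = x11) * (mx22 x11 x12 x21 x22 0 1 = x12) *
  (mx22 x11 x12 x21 x22 1 0 = x21) * (mx22 x11 x12 x21 x22 1 1 = x22).
Proof. by rewrite !mxE. Qed.

Lemma qin_svecE (a m : int) (k : nat) (X := qin_state a m k) :
  (qin_svec a m k 1 0 0 = X 0 0) * (qin_svec a m k 1 0 1 = - X 0 1) *
  (qin_svec a m k 2 0 0 = X 1 0) * (qin_svec a m k 2 0 1 = X 1 1).
Proof.
have e0 : inord 0 = 0 :> 'I_2 by apply/val_inj; rewrite /= inordK.
have e1 : inord 1 = 1 :> 'I_2 by apply/val_inj; rewrite /= inordK.
by rewrite /qin_svec /= e0 e1 ![row _ _ _ _]mxE !mx22E.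
Qed.

Lemma qin_innerE (a m : int) (k : nat) (X := qin_state a m k) :
  qin_inner a m k = X 0 0 * X 1 0 - X 0 1 * X 1 1.
Proof.
have lift1 : lift ord0 ord0 = 1 :> 'I_2 by apply/val_inj.
by rewrite /qin_inner /dotv !big_ord_recl big_ord0 lift1 !qin_svecE addr0 mulNr.
Qed.

Lemma qin_remainder (x y : int) : 1 < x -> x < y -> coprimez x y ->
  let r := y - ((y - 1) %/ x)%Z * x in
  [/\ 0 < r, r < x & coprimez x r].
Proof.
move=> x1 xy cxy r.
have x0 : x != 0 by lia.
have rE : r = ((y - 1) %% x)%Z + 1 by rewrite /r /modz; ring.
have c : coprimez x r.
  have -> : r = (- ((y - 1) %/ x)%Z) * x + y by rewrite /r; ring.
  by rewrite /coprimez gcdzMDl.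
have r0 := modz_ge0 (y - 1) x0.
have rx : ((y - 1) %% x)%Z < x by rewrite ltz_pmod //; lia.
have rnx : r <> x by move=> e; move: c; rewrite e /coprimez gcdzz; lia.
split => //; lia.
Qed.

Lemma qin_terminates (a m : int) : 1 < a -> a < m -> coprimez a m ->
  exists N : nat, qin_terminal a m N.
Proof.
move=> a1 am cam.
suff [N HN] : exists N : nat, qin_state a m N 0 1 == 1.
  have ex : exists N : nat, qin_state a m N 0 1 == 1 by exists N.
  case: (ex_minnP ex) => M /eqP HM Hmin; exists M; split=> // k kM /eqP /Hmin.
  by rewrite leqNgt kM.
(* Two consecutive steps strictly decrease the upper right entry. *)
suff: forall (n k : nat) (X := qin_state a m k), ~~ odd k -> 1 < X 0 1 ->
    X 0 1 < X 1 1 -> coprimez (X 0 1) (X 1 1) -> X 0 1 <= n%:Z ->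
    exists N : nat, qin_state a m N 0 1 == 1.
  move=> H; apply: (H `|a|%N 0%N); rewrite /= ?mx22E //; lia.
elim=> [|n IH] k X ek x1 xy cxy xn; first lia.
have [r0 rx cr] := qin_remainder x1 xy cxy.
set q := divz _ _ in r0 rx cr; set r := _ - q * _ in r0 rx cr.
have X1 : qin_state a m k.+1 = mx22 (X 0 0) (X 0 1) (X 1 0 + q * X 0 0) r.
  by rewrite [LHS]/= /qin_step /qin_quo /= ek.
have X2 : qin_state a m k.+2 =
    let q' := divz (X 0 1 - 1) r in
    mx22 (X 0 0 + q' * (X 1 0 + q * X 0 0)) (X 0 1 - q' * r)
         (X 1 0 + q * X 0 0) r.
  have -> : qin_state a m k.+2 = qin_step k.+2 (qin_state a m k.+1) by [].
  by rewrite X1 /qin_step /qin_quo /= (negbTE ek) !mx22E.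
have [r1|r1] := eqVneq r 1.
  by exists k.+2; rewrite X2 !mx22E r1 divz1; apply/eqP; ring.
have r1' : 1 < r by lia.
have crx : coprimez r (X 0 1) by rewrite /coprimez gcdzC.
have [s0 sr cs] := qin_remainder r1' rx crx.
cbv zeta in X2; set s := X 0 1 - _ in s0 sr cs X2.
have [s1|s1] := eqVneq s 1; first by exists k.+2; rewrite X2 !mx22E s1.
apply: (IH k.+2); rewrite ?X2 ?mx22E //=.
- by rewrite negbK.
- lia.
- by rewrite /coprimez gcdzC.
- lia.
Qed.

(* Main.v *)
(* Up to order, consecutive s-bases are [(f, g)] and [(g + q f, f)], where the *)
(* sign pattern of the entries persists, and [D_k = |f|^2 - |g|^2].  When      *)
(* [<f, g> <= 0 <= <f, g + q f>], each lattice vector [s g + n f] with [s > 0] *)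
(* is at least as long as [g] if [n <= 0], as [g + q f] if [n >= s q], and, by *)
(* comparing coordinates, as [f] in between.  Hence a shortest vector occurs   *)
(* among [f], [g], [g + q f]; as [|g + q f|^2 - |g|^2] is [q] times the sum of *)
(* the two inner products, the hypothesis on their absolute values discards    *)
(* one of the last two.                                                        *)
Require Import Defs.
From mathcomp Require Import all_boot all_order all_algebra.
From mathcomp Require Import zify ring lra.
Import Order.TTheory GRing.Theory Num.Theory.
Local Open Scope ring_scope.

(** Every s-state is a lattice basis ([qin_basis], [qin_lattice]) whose rows have nonnegative first
    entries and second entries of opposite signs ([qin_signs]). Where the inner product stops being
    negative, [sqnorm_comb_ge_min] leaves three candidates for the minimum. [sqnorm_step] compares
    the old moved row with its replacement, and [qin_DE] turns the sign of [qin_D] into a comparison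
    of the two rows of one state. *)

Lemma dotvE (u v : 'rV[int]_2) : dotv u v = u 0 0 * v 0 0 + u 0 1 * v 0 1.
Proof.
have lift1 : lift ord0 ord0 = 1 :> 'I_2 by apply/val_inj.
by rewrite /dotv !big_ord_recl big_ord0 lift1 addr0.
Qed.

Lemma dotvC (u v : 'rV[int]_2) : dotv u v = dotv v u.
Proof. by rewrite !dotvE; ring. Qed.

Lemma rV2P (u v : 'rV[int]_2) : u 0 0 = v 0 0 -> u 0 1 = v 0 1 -> u = v.
Proof.
move=> e0 e1; apply/rowP => j.
have : j = 0 \/ j = 1 by case: j => [[|[|//]] lt_j]; [left|right]; apply/val_inj.
by case=> ->.
Qed.

Lemma rV_combE (R : pzRingType) (n : nat) (u v : 'rV[R]_n) (s t : R) i :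
  (s *: v + t *: u) 0 i = s * v 0 i + t * u 0 i.
Proof. by rewrite !mxE. Qed.

(** The terms [s * y] and [- t * x] never have opposite signs, so their absolute values add up, and
    the second is already at least that of [x]. *)
Lemma sqr_comb_ge (R : realDomainType) (x y s t : R) :
  0 <= s -> 1 <= t -> y * x <= 0 -> x ^+ 2 <= (s * y - t * x) ^+ 2.
Proof.
move=> s0 t1 xy.
have st : s * t * (y * x) <= 0 by rewrite mulr_ge0_le0 // mulr_ge0 //; lra.
have tx : 0 <= (t - 1) * (t + 1) * x ^+ 2.
  by rewrite mulr_ge0 ?sqr_ge0 // mulr_ge0 //; lra.
have sy := sqr_ge0 (s * y).
nra.
Qed.

Lemma sqnorm_comb (u v : 'rV[int]_2) (s n : int) :
  sqnorm (s *: v + n *: u) =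
  s ^+ 2 * sqnorm v + s * n * 2 * dotv u v + n ^+ 2 * sqnorm u.
Proof. by rewrite dotvE /sqnorm !mxE; ring. Qed.

Lemma sqnorm_ge0 (u : 'rV[int]_2) : 0 <= sqnorm u.
Proof. by rewrite addr_ge0 ?sqr_ge0. Qed.

Lemma sqr_int_ge1 (s : int) : s != 0 -> 1 <= s ^+ 2.
Proof. by move=> s0; rewrite -gtz0_ge1 exprn_even_gt0. Qed.

Lemma sqnorm_comb_ge (u v : 'rV[int]_2) (s n : int) :
  s != 0 -> 0 <= s * n * dotv u v -> sqnorm v <= sqnorm (s *: v + n *: u).
Proof.
move=> /sqr_int_ge1 s1 h; rewrite sqnorm_comb.
have h1 : 0 <= (s ^+ 2 - 1) * sqnorm v by rewrite mulr_ge0 ?sqnorm_ge0 ?subr_ge0.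
have h2 : 0 <= n ^+ 2 * sqnorm u by rewrite mulr_ge0 ?sqnorm_ge0 ?sqr_ge0.
lia.
Qed.

Section Step.

Variables (u v : 'rV[int]_2) (q : int).
Let v' := v + q *: u.
Hypotheses (u_ge0 : 0 <= u 0 0) (v_ge0 : 0 <= v 0 0).
Hypothesis (v'u_le0 : v' 0 1 * u 0 1 <= 0).
Hypotheses (duv : dotv u v <= 0) (dv'u : 0 <= dotv v' u).

Lemma sqnorm_comb_ge_min (s n : int) : 0 <= s -> s *: v + n *: u != 0 ->
  [\/ sqnorm u <= sqnorm (s *: v + n *: u),
      sqnorm v <= sqnorm (s *: v + n *: u) |
      sqnorm v' <= sqnorm (s *: v + n *: u)].
Proof.
move=> s0 w0.
have [se0|sn0] := eqVneq s 0.
  apply: Or31; rewrite addrC; apply: sqnorm_comb_ge; last by rewrite se0; lia.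
  by apply: contraNneq w0 => ->; rewrite se0 !scale0r addr0.
have s1 : 1 <= s by lia.
have [nle0|n0] := leP n 0.
  by apply/Or32/sqnorm_comb_ge => //; rewrite mulr_le0 // mulr_ge0_le0.
have [nge|nlt] := leP (s * q) n.
  (* In terms of [v'] and [u] both coefficients and the inner product are nonnegative. *)
  apply: Or33.
  have -> : s *: v + n *: u = s *: v' + (n - s * q) *: u.
    by rewrite scalerDr scalerA -addrA -scalerDl [s * q + _]addrC subrK.
  apply: sqnorm_comb_ge => //; rewrite mulr_ge0 ?mulr_ge0 ?subr_ge0 //.
  by rewrite dotvC.
(* Here [0 < n < s * q]: the first coordinate dominates since nothing cancels in it; the second is
   rewritten through [v'], whose second entry is opposite in sign to that of [u]. *)
apply: Or31; rewrite /sqnorm !mxE; apply: lerD.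
  have uw : u 0 0 <= s * v 0 0 + n * u 0 0.
    by rewrite ler_wpDl ?mulr_ge0 // ler_peMl //; lia.
  by rewrite ler_sqr // nnegrE // (le_trans u_ge0).
have -> : s * v 0 1 + n * u 0 1 = s * v' 0 1 - (s * q - n) * u 0 1.
  by rewrite !mxE; ring.
by apply: sqr_comb_ge => //; lia.
Qed.

Lemma sqnorm_step :
  sqnorm v' = sqnorm v + q * (dotv u v + dotv v' u).
Proof. by rewrite /v' !dotvE /sqnorm !mxE; ring. Qed.

End Step.

Lemma latticeP (a m : int) (w : 'rV[int]_2) :
  reflect (exists c : int, a * w 0 0 + w 0 1 = c * m) (w \in lattice a m).
Proof. by rewrite inE eqz_mod_dvd subr0; apply: dvdzP. Qed.

Lemma lattice_comb (a m s n : int) (v u : 'rV[int]_2) :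
  v \in lattice a m -> u \in lattice a m -> s *: v + n *: u \in lattice a m.
Proof.
move=> /latticeP[c hc] /latticeP[d hd]; apply/latticeP; exists (s * c + n * d).
by rewrite !mxE mulrDl -!mulrA -hc -hd; ring.
Qed.

(* The row that step [k.+1] adds to the other one, and that other row. *)
Definition qin_fixed (a m : int) (k : nat) := qin_svec a m k (1 + odd k).
Definition qin_moved (a m : int) (k : nat) := qin_svec a m k (2 - odd k).

Section Algorithm.

Variables (a m : int).

Let f := qin_fixed a m.
Let g := qin_moved a m.

Lemma qin_stateS (k : nat) :
  qin_state a m k.+1 = qin_step k.+1 (qin_state a m k).
Proof. by []. Qed.

Lemma qin_movedS (k : nat) : g k.+1 = f k.
Proof.
rewrite /f /g /qin_fixed /qin_moved.
by apply: rV2P; rewrite /=; case ok: (odd k);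
  rewrite /= !qin_svecE qin_stateS /qin_step /= ok !mx22E.
Qed.

Lemma qin_fixedS (k : nat) : f k.+1 = g k + qin_q a m k.+1 *: f k.
Proof.
have addE i : (g k + qin_q a m k.+1 *: f k) 0 i =
              g k 0 i + qin_q a m k.+1 * f k 0 i.
  by rewrite -[g k]scale1r rV_combE scale1r mul1r.
apply: rV2P; rewrite addE /f /g /qin_fixed /qin_moved /=; case ok: (odd k);
  by rewrite /= !qin_svecE qin_stateS /qin_step /= ok !mx22E //; ring.
Qed.

Lemma qin_inner_dotv (k : nat) : qin_inner a m k = dotv (f k) (g k).
Proof.
rewrite /f /g /qin_fixed /qin_moved /qin_inner.
by case: (odd k); rewrite // dotvC.
Qed.

(** The alternating signs make all terms with [j < k] cancel in [qin_D a m k.+1 + qin_D a m k]. *)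
Lemma qin_DS (k : nat) :
  qin_D a m k.+1 =
  qin_q a m k.+1 * (qin_inner a m k + qin_inner a m k.+1) - qin_D a m k.
Proof.
rewrite /qin_D big_nat_recr //=.
under eq_big_nat => j /andP[_ jk].
  have -> : (k.+1 - 1 - j = (k - 1 - j).+1)%N by lia.
  rewrite exprS !mulN1r !mulNr.
  over.
by rewrite sumrN subSS subn0 subnn expr0 exprS /qin_q; ring.
Qed.

(** By [sqnorm_step] the difference of squared lengths obeys the recurrence [qin_DS]; it starts at
    [a ^+ 2 + 1 - m ^+ 2]. *)
Lemma qin_DE (k : nat) : qin_D a m k = sqnorm (f k) - sqnorm (g k).
Proof.
elim: k => [|k IH].
  rewrite /qin_D big_geq // /sqnorm /f /g /qin_fixed /qin_moved /=.
  by rewrite !qin_svecE /= !mx22E; ring.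
rewrite qin_DS IH !qin_inner_dotv qin_movedS qin_fixedS sqnorm_step.
by ring.
Qed.

Lemma qin_basis (k : nat) (w : 'rV[int]_2) : w \in lattice a m ->
  exists s n : int, w = s *: g k + n *: f k.
Proof.
move=> wL; elim: k => [|k [s [n ->]]].
  (* Initially [f] is [(1, -a)] and [g] is [(0, m)]. *)
  have /latticeP[c hc] := wL; exists c, (w 0 0).
  by apply: rV2P; rewrite rV_combE /f /g /qin_fixed /qin_moved /= !qin_svecE /=
    !mx22E; lia.
exists (n - s * qin_q a m k.+1), s.
by rewrite qin_movedS qin_fixedS scalerDr scalerA scalerBl addrCA subrK.
Qed.

Lemma qin_lattice (k : nat) : (f k \in lattice a m) && (g k \in lattice a m).
Proof.
elim: k => [|k /andP[fL gL]].
  apply/andP; split; apply/latticeP; [exists 0 | exists 1];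
  by rewrite /f /g /qin_fixed /qin_moved /= !qin_svecE /= !mx22E; ring.
by rewrite qin_movedS qin_fixedS fL andbT -[g k]scale1r lattice_comb.
Qed.

Hypotheses (a_gt0 : 0 < a) (m_gt0 : 0 < m).

(** Dividing [y - 1] instead of [y] makes the new entry [(y - 1) mod x + 1], hence positive. *)
Lemma qin_quo_bounds (x y : int) : 0 < x -> 0 < y ->
  0 <= ((y - 1) %/ x)%Z /\ 0 < y - ((y - 1) %/ x)%Z * x.
Proof.
move=> x0 y0; have := divz_eq (y - 1) x; have := @modz_ge0 (y - 1) x.
by rewrite divz_ge0 //; lia.
Qed.

Lemma qin_state_ge0 (k : nat) (X := qin_state a m k) :
  [/\ 0 <= X 0 0, 0 <= X 1 0, 0 < X 0 1 & 0 < X 1 1].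
Proof.
rewrite {}/X; elim: k => [|k []]; first by rewrite /= !mx22E.
rewrite qin_stateS /qin_step /qin_quo /=.
set Y := qin_state a m k => Y00 Y10 Y01 Y11.
have [q1 r1] := qin_quo_bounds _ _ Y01 Y11.
have [q2 r2] := qin_quo_bounds _ _ Y11 Y01.
by case: (odd k); rewrite /= !mx22E; split=> //; rewrite addr_ge0 // mulr_ge0.
Qed.

Lemma qin_q_ge0 (k : nat) : 0 <= qin_q a m k.
Proof.
case: k => //= k; rewrite /qin_quo /=.
have [_ _ X01 X11] := qin_state_ge0 k.
have [q1 _] := qin_quo_bounds _ _ X01 X11.
by have [q2 _] := qin_quo_bounds _ _ X11 X01; case: (odd k).
Qed.

Lemma qin_signs (k : nat) :
  [/\ 0 <= f k 0 0, 0 <= g k 0 0 & f k 0 1 * g k 0 1 < 0].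
Proof.
have [X00 X10 X01 X11] := qin_state_ge0 k.
rewrite /f /g /qin_fixed /qin_moved.
by case: (odd k); rewrite /= !qin_svecE; split=> //;
  rewrite ?mulrN ?mulNr oppr_lt0 mulr_gt0.
Qed.

Lemma qin_neq0 (k : nat) : (f k != 0) && (g k != 0).
Proof.
have [_ _ fg] := qin_signs k.
apply/andP; split; apply: contraTneq fg => ->.
  by rewrite mxE mul0r ltxx.
by rewrite [X in _ * X]mxE mulr0 ltxx.
Qed.

Lemma qin_sqnorm_ge_min (k : nat) (w : 'rV[int]_2) :
  qin_inner a m k <= 0 -> 0 <= qin_inner a m k.+1 ->
  w \in lattice a m -> w != 0 ->
  [\/ sqnorm (f k) <= sqnorm w, sqnorm (g k) <= sqnorm w |
      sqnorm (f k.+1) <= sqnorm w].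
Proof.
move=> I0 I1 wL w0.
have [f0 g0 _] := qin_signs k; have [_ _] := qin_signs k.+1.
move: I0 I1; rewrite !qin_inner_dotv qin_movedS qin_fixedS => I0 I1 /ltW fg.
have min_comb := @sqnorm_comb_ge_min _ _ _ f0 g0 fg I0 I1.
have [s [n wE]] := qin_basis k w wL.
have [s0|s0] := leP 0 s; first by rewrite wE; apply: min_comb; rewrite -?wE.
(* Negation preserves length and makes the coefficient of [g k] positive. *)
have NwE : - w = (- s) *: g k + (- n) *: f k by rewrite wE opprD !scaleNr.
have -> : sqnorm w = sqnorm (- w) by rewrite /sqnorm !mxE !sqrrN.
by rewrite NwE; apply: min_comb; rewrite -?NwE ?oppr_eq0 //; lia.
Qed.

End Algorithm.

Theorem theorem4p1 (a m : int) (ha : 1 < a) (ham : a < m)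
    (hcop : coprimez a m)
    (N : nat) (hN : qin_terminal a m N)
    (k0 : nat) (hk0 : (k0 < N)%N)
    (hneg : qin_inner a m k0 < 0) (hnneg : 0 <= qin_inner a m k0.+1) :
  (`|qin_inner a m k0.+1| <= `|qin_inner a m k0| ->
     (0 <= qin_D a m k0.+1 ->
        is_shortest a m (qin_svec a m k0.+1 (2 - odd k0.+1))) /\
     (qin_D a m k0.+1 <= 0 ->
        is_shortest a m (qin_svec a m k0.+1 (1 + odd k0.+1)))) /\
  (`|qin_inner a m k0| <= `|qin_inner a m k0.+1| ->
     (0 <= qin_D a m k0 ->
        is_shortest a m (qin_svec a m k0 (2 - odd k0))) /\
     (qin_D a m k0 <= 0 ->
        is_shortest a m (qin_svec a m k0 (1 + odd k0)))).
Proof.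
rewrite -!/(qin_fixed a m _) -!/(qin_moved a m _) !qin_DE qin_movedS.
have a0 : 0 < a by lia.
have m0 : 0 < m by lia.
have minw w := qin_sqnorm_ge_min a m a0 m0 k0 w (ltW hneg) hnneg.
have /andP[fL gL] := qin_lattice a m k0.
have /andP[f'L _] := qin_lattice a m k0.+1.
have /andP[f0 g0] := qin_neq0 a m a0 m0 k0.
have /andP[f'0 _] := qin_neq0 a m a0 m0 k0.+1.
have q0 := qin_q_ge0 a m a0 m0 k0.+1.
have stepE : sqnorm (qin_fixed a m k0.+1) = sqnorm (qin_moved a m k0)
    + qin_q a m k0.+1 * (qin_inner a m k0 + qin_inner a m k0.+1).
  by rewrite !qin_inner_dotv qin_movedS qin_fixedS sqnorm_step.
rewrite (ltr0_norm hneg) (ger0_norm hnneg).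
(* Since [q >= 0], [stepE] and [hI] discard the longer of [g] at [k0] and [f] at [k0.+1]; [hD]
   decides between the survivor and [f] at [k0]. *)
by split=> hI; split=> hD; split=> // w wL w0; case: (minw w wL w0); nia.
Qed.
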